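(* Let $\mathcal{G}\subset\mathbb{N}$ be a set of pairwise coprime positive integers, and let $\mathcal{H}=\{h_1,\dots,h_u\}$ be a set of $u$ integers which is admissible with respect to $\mathcal{G}$, i.e. $\nu_g(\mathcal{H})<g$ for all $g\in\mathcal{G}$. Let \[ \mathcal{V}=\{n\in\mathbb{N}:\ n\not\equiv h_t \ (\mathrm{mod}\ g)\ \text{for all } t\le u \text{ and all } g\in\mathcal{G}\},\qquad \mathcal{V}(x)=\mathcal{V}\cap[1,x]. \] Suppose the family $(\mathcal{A}_x)_x$ satisfies Condition A with some parameter $\theta\in(0,1)$. Then for every $\varepsilon>0$, \[ |\mathcal{V}(x)|=cx+O\left(x^{\frac{u\theta}{u\theta-\theta+1}+\varepsilon}\right),\qquad c=\prod_{g\in\mathcal{G}}\left(1-\frac{\nu_g(\mathcal{H})}{g}\right). \]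
   Context: $\mathbb{N}$ is the set of positive integers. $\nu_g(\mathcal{H})$ is the number of distinct residue classes modulo $g$ occupied by the elements of $\mathcal{H}$. $\mathcal{A}$ is the set consisting of $1$ and all products $g_1g_2\cdots g_s$ ($s\ge1$) of distinct elements $g_i\in\mathcal{G}$, and $\mathcal{A}_x=\{a\in\mathcal{A}: a\le x^{A_0}\}$ for a fixed large constant $A_0$. Condition A with parameter $\theta\in(0,1]$: a family $(\mathcal{A}_x)_{x>0}$ of sets of positive integers satisfies it if (i) there is a constant $A_0>0$ with $a\ll x^{A_0}$ for all $a\in\mathcal{A}_x$, and (ii) for every $\varepsilon>0$ and $A>0$, $|\mathcal{A}_x\cap[1,y]|\ll y^{\theta}(\log y)^{-A}$ for all $y\gg x^{\varepsilon}$ (for all sufficiently large $x$). *)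

(* Defs.v *)
From HB Require Import structures.
From mathcomp Require Import all_boot all_order all_algebra finmap.
From mathcomp Require Import all_classical all_reals all_analysis.

Set Implicit Arguments.
Unset Strict Implicit.
Unset Printing Implicit Defensive.

Import Order.TTheory GRing.Theory Num.Theory.
Import numFieldNormedType.Exports.

Local Open Scope classical_set_scope.
Local Open Scope ring_scope.

Definition upto (R : realType) (A : set nat) (x : R) : set nat :=
  A `&` [set n | (0 < n)%N /\ n%:R <= x].

(* [fset_set] is junk on infinite sets; this shows it is not so used below. *)
Lemma finite_upto (R : realType) (A : set nat) (x : R) :
  finite_set (upto A x).
Proof.
apply: (@sub_finite_set _ _ `I_(Num.bound x).+1); last exact: finite_II.
move=> n [_ [_ /= nx]]; rewrite ltnS -(@ler_nat R).
case: (lerP 0 x) => [x0|x0]; first exact: le_trans nx (ltW (archi_boundP x0)).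
by have := lt_le_trans x0 (le_trans (ler0n R n) nx); rewrite ltxx.
Qed.

Definition count_upto (R : realType) (A : set nat) (x : R) : nat :=
  #|` fset_set (upto A x)|%fset.

Definition nu (H : {fset int}) (g : nat) : nat :=
  #|` [fset (h %% g%:Z)%Z | h in H]%fset|%fset.

Definition admissible (G : set nat) (H : {fset int}) : Prop :=
  forall g, G g -> (nu H g < g)%N.

Definition pairwise_coprime (G : set nat) : Prop :=
  forall g g', G g -> G g' -> g <> g' -> coprime g g'.

Definition sifted (G : set nat) (H : {fset int}) : set nat :=
  [set n | (0 < n)%N /\
    forall h g, h \in H -> G g -> (n%:Z != h %[mod g%:Z])%Z].

(* The empty product accounts for the element 1. *)
Definition products (G : set nat) : set nat :=
  [set a | exists2 S : {fset nat}, [set` S] `<=` G & a = (\prod_(g <- S) g)%N].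

Definition products_le (R : realType) (G : set nat) (A0 x : R) : set nat :=
  [set a | products G a /\ a%:R <= x `^ A0].

(* Every implied constant may depend on eps, B and k (k being the one implied
   in "y >> x^eps"), but not on x, y. *)
Definition condition_A (R : realType) (theta : R) (A : R -> set nat) : Prop :=
  (exists2 A0 : R, 0 < A0 & exists C : R,
     forall x, 0 < x -> forall a, A x a -> a%:R <= C * x `^ A0) /\
  (forall eps B k : R, 0 < eps -> 0 < B -> 0 < k -> exists C : R,
     \forall x \near +oo, forall y, k * x `^ eps <= y ->
       (count_upto (A x) y)%:R <= C * (y `^ theta * ln y `^ (- B))).

Definition density_partial (R : realType) (G : set nat) (H : {fset int})
    (N : nat) : R :=
  \prod_(0 <= g < N | g \in G) (1 - (nu H g)%:R / g%:R).

(* The product over G, taken in increasing order of g; by the lemma below the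
   limit exists, and as all factors lie in ]0, 1] the order is immaterial. *)
Definition density (R : realType) (G : set nat) (H : {fset int}) : R :=
  lim (density_partial R G H N @[N --> \oo]).

Lemma cvg_density (R : realType) (G : set nat) (H : {fset int}) :
  admissible G H -> cvg (density_partial R G H N @[N --> \oo]).
Proof.
move=> adm.
have fac g : g \in G -> 0 <= (1 - (nu H g)%:R / g%:R : R) <= 1.
  move=> /set_mem /adm lt_nu; have g0 : 0 < g%:R :> R.
    by rewrite ltr0n (leq_ltn_trans _ lt_nu).
  by rewrite subr_ge0 ler_pdivrMr // mul1r ler_nat ltnW //= gerBl divr_ge0.
have ge0 N : 0 <= density_partial R G H N.
  rewrite /density_partial; apply: prodr_ge0 => g gG; by case/andP: (fac g gG).
apply: nonincreasing_is_cvgn; last by exists 0 => _ [N _ <-].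
apply/nonincreasing_seqP => N; rewrite /density_partial big_mkcond /=.
rewrite big_nat_recr //= -big_mkcond /=.
by case: ifPn => [/fac /andP[_ le1]|_]; rewrite ?mulr1 // ler_piMr // ge0.
Qed.

(* Main.v *)
(* Write a(S) for the product of a finite set S of elements of G, and say that S
   hits n if every g in S divides n - h for some h in H. Inclusion-exclusion
   writes the sifted count as the sum over S of (-1)^|S| times the number of n
   hit by S, which by the Chinese remainder theorem is nu(S) x / a(S) + O(nu(S)).
   This is used for a(S) <= z^u only. If a(S) > z^u and S hits n, then some h in
   H and some part S' of S satisfy a(S') > z and a(S') | n - h, so such n are
   O(x z^(s-1)) in number, and each is hit by O(x^eps) sets S. Condition A gives
   the convergence of the sum of g^-s over G for s > theta, and Rankin's trick
   then bounds all tails: the error is about z^(u s) + x^(1+eps) z^(s-1), which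
   is optimal at z = x^(1/(u theta - theta + 1)). *)

Require Import Defs.
From HB Require Import structures.
From mathcomp Require Import all_boot all_order all_algebra finmap.
From mathcomp Require Import all_classical all_reals all_analysis.
Import Order.TTheory GRing.Theory Num.Theory.
Import numFieldNormedType.Exports.
From mathcomp Require Import unstable zify ring lra.
Local Open Scope classical_set_scope.
Local Open Scope ring_scope.

(** * Residue classes hit by [H], and the Chinese remainder theorem *)

(** Uses the residue set whose size is [nu H g], so that a full period contains exactly that many
    hits; [hitsP] is the divisibility form. *)
Definition hits (H : {fset int}) (g n : nat) : bool :=
  (n%:Z %% g%:Z)%Z \in [fset (h %% g%:Z)%Z | h in H]%fset.

Lemma hitsP (H : {fset int}) (g n : nat) :
  reflect (exists2 h, h \in H & (g%:Z %| n%:Z - h)%Z) (hits H g n).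
Proof.
apply: (iffP (imfsetP _ _ _ _)) => /= -[h hH e]; exists h => //.
  by rewrite -eqz_mod_dvd; apply/eqP.
by apply/eqP; rewrite eqz_mod_dvd.
Qed.

Lemma hits1 (h : int) (g n : nat) : hits [fset h]%fset g n = (g%:Z %| n%:Z - h)%Z.
Proof.
apply/hitsP/idP => [[k /fset1P -> //]|gh].
by exists h; rewrite ?fset11.
Qed.

Lemma nu1 (h : int) (g : nat) : nu [fset h]%fset g = 1%N.
Proof. by rewrite /nu imfset_fset1 cardfs1. Qed.

Lemma nu_le (H : {fset int}) (g : nat) : (nu H g <= #|` H|%fset)%N.
Proof. exact: leq_imfset_card. Qed.

Lemma hits_mod (H : {fset int}) (g d n : nat) :
  (g %| d)%N -> hits H g (n %% d) = hits H g n.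
Proof.
by move=> gd; rewrite /hits !modz_nat modn_dvdm.
Qed.

Lemma sum_hits (H : {fset int}) (g : nat) :
  (0 < g)%N -> (\sum_(0 <= n < g) hits H g n = nu H g)%N.
Proof.
move=> g0; rewrite (eq_bigr (fun n => if hits H g n then 1 else 0)%N); last first.
  by move=> n _; case: hits.
rewrite -big_mkcond sum1_count -size_filter -(size_map Posz).
apply/perm_size/uniq_perm; rewrite ?fset_uniq //.
  by rewrite map_inj_uniq ?filter_uniq ?iota_uniq // => m n [].
move=> r; apply/mapP/idP => [[n]|rF].
  rewrite mem_filter mem_index_iota => /andP[hn /andP[_ ng]] ->.
  by move: hn; rewrite /hits modz_nat modn_small.
have /imfsetP[/= h _ rE] := rF.
have gn0 : g%:Z != 0 by rewrite lt0r_neq0.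
have [m rm] : exists m, r = Posz m.
  by have := modz_ge0 h gn0; rewrite -rE; case: (r) => // m _; exists m.
have mg : (m < g)%N by have := ltz_mod h gn0; rewrite -rE rm; lia.
exists m => //; rewrite mem_filter mem_index_iota mg !andbT.
by rewrite /hits modz_nat modn_small // -rm.
Qed.

(** By the Chinese remainder theorem, reduction modulo [a] and [b] is a bijection from residues
    modulo [a * b] to pairs of residues. *)
Lemma sum_mul_coprime (a b : nat) (P Q : nat -> nat) :
  (0 < a)%N -> (0 < b)%N -> coprime a b ->
  (forall n, P (n %% a)%N = P n) -> (forall n, Q (n %% b)%N = Q n) ->
  (\sum_(0 <= n < a * b) P n * Q n =
   (\sum_(0 <= n < a) P n) * (\sum_(0 <= n < b) Q n))%N.
Proof.
case: a b => [//|a] [//|b] _ _ cab Pa Qb.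
pose f (n : 'I_(a.+1 * b.+1)) : 'I_a.+1 * 'I_b.+1 := (inord (n %% a.+1), inord (n %% b.+1)).
have f_bij : bijective f.
  apply: inj_card_bij; last by rewrite card_prod !card_ord.
  move=> m n [/(congr1 (@nat_of_ord _)) + /(congr1 (@nat_of_ord _))].
  rewrite !inordK ?ltn_pmod // => ea eb; apply: val_inj => /=.
  have /eqP : m == n %[mod a.+1 * b.+1] by rewrite chinese_remainder // ea eb !eqxx.
  by rewrite !modn_small.
rewrite !big_mkord big_distrlr /= pair_big /= (reindex f) /=; last exact: onW_bij.
by apply: eq_bigr => n _; rewrite !inordK ?ltn_pmod // Pa Qb.
Qed.

Lemma sum_hits_prod (H : {fset int}) (r : seq nat) :
  all (fun g => 0 < g)%N r -> pairwise coprime r ->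
  (\sum_(0 <= n < \prod_(g <- r) g) \prod_(g <- r) hits H g n =
   \prod_(g <- r) nu H g)%N.
Proof.
elim: r => [|g r IH] /=; first by rewrite !big_nil big_nat1 big_nil.
move=> /andP[g0 r0] /andP[cgr cr]; rewrite !big_cons -IH // -sum_hits //.
rewrite -sum_mul_coprime //.
- by apply: eq_bigr => n _; rewrite big_cons.
- by rewrite big_seq_cond prodn_cond_gt0 // => i /andP[/(allP r0)].
- elim: (r) cgr => [|h r' IHr] /=; first by rewrite big_nil coprimen1.
  by case/andP=> cgh /IHr cgr'; rewrite big_cons coprimeMr cgh.
- by move=> n; rewrite hits_mod.
- move=> n; rewrite [LHS]big_seq [RHS]big_seq; apply: eq_bigr => h hr.
  by rewrite hits_mod // (big_rem h) //= dvdn_mulr.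
Qed.

(** * Periodic sums over intervals *)

Lemma sum_periodic (a : nat) (P : nat -> nat) (c m : nat) :
  (forall n, P (n + a)%N = P n) -> (\sum_(0 <= n < a) P n = c)%N ->
  (\sum_(m <= n < m + a) P n = c)%N.
Proof.
move=> Pa <-; elim: m => [|m <-]; first by rewrite add0n.
case: a Pa => [|a] Pa; first by rewrite !addn0 !big_geq.
have m_lt : (m < m + a.+1)%N by rewrite addnS ltnS leq_addr.
by rewrite addSn [LHS]big_nat_recr //= Pa [RHS]big_ltn // addnC.
Qed.

Lemma sum_periodic_mul (a : nat) (P : nat -> nat) (c m q : nat) :
  (forall n, P (n + a)%N = P n) -> (\sum_(0 <= n < a) P n = c)%N ->
  (\sum_(m <= n < m + q * a) P n = q * c)%N.
Proof.
move=> Pa cE; elim: q => [|q IH]; first by rewrite addn0 big_geq.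
rewrite (@big_cat_nat _ _ _ (m + q * a)) ?leq_addr //=; last by rewrite leq_add2l mulSn leq_addl.
have -> : (m + q.+1 * a = m + q * a + a)%N by rewrite mulSn -addnA [(q * a + a)%N]addnC.
by rewrite IH (sum_periodic a P c) // addnC mulSn.
Qed.

(** Whole periods contribute exactly their expected share. The incomplete last period and its share
    both lie between 0 and [c]. *)
Lemma sum_periodic_dist (R : realType) (a : nat) (P : nat -> nat) (c m M : nat) :
  (0 < a)%N ->
  (forall n, P (n + a)%N = P n) -> (\sum_(0 <= n < a) P n = c)%N ->
  `|(\sum_(m <= n < m + M) P n)%:R - M%:R * (c%:R / a%:R)| <= c%:R :> R.
Proof.
move=> a0 Pa cE; have aR : 0 < a%:R :> R by rewrite ltr0n.
rewrite {1 2}(divn_eq M a) addnA.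
rewrite (@big_cat_nat _ _ _ (m + M %/ a * a)) ?leq_addr //=.
rewrite (sum_periodic_mul a P c) //.
set s := (\sum_(_ <= n < _) _)%N; have sc : (s <= c)%N.
  rewrite -(sum_periodic a P c (m + M %/ a * a)) // /s.
  rewrite [leqRHS](@big_cat_nat _ _ _ (m + M %/ a * a + M %% a)) ?leq_addr //= ?leq_add2l ?leq_addr //.
  by rewrite ltnW // ltn_pmod.
rewrite !natrD !natrM mulrDl.
have -> : (M %/ a)%:R * c%:R + s%:R
    - ((M %/ a)%:R * a%:R * (c%:R / a%:R) + (M %% a)%:R * (c%:R / a%:R))
  = s%:R - (M %% a)%:R / a%:R * c%:R :> R.
  by field; rewrite gt_eqF.
have sR : s%:R <= c%:R :> R by rewrite ler_nat.
have t0 : 0 <= (M %% a)%:R / a%:R * c%:R :> R by rewrite !mulr_ge0 ?invr_ge0.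
have t1 : (M %% a)%:R / a%:R * c%:R <= c%:R :> R.
  by rewrite ler_piMl // ler_pdivrMr // mul1r ler_nat ltnW // ltn_pmod.
have := ler0n R s.
by rewrite ler_norml; lra.
Qed.

(** Starting beyond [N0] keeps [n - h] nonzero, of size at most [2 N], so no [d > 2 N] divides it.
    For [d <= 2 N] the error 1 of the periodic count is at most [2 N / d], hence the factor 3. *)
Lemma count_hits1_le (R : realType) (d N0 N : nat) (h : int) :
  (0 < d)%N -> (`|h| <= N0)%N ->
  (\sum_(N0.+1 <= n < N.+1) hits [fset h]%fset d n)%:R <= 3 * N%:R / d%:R :> R.
Proof.
move=> d0 hN0; have dR : 0 < d%:R :> R by rewrite ltr0n.
have [NN0|N0N] := leqP N N0.
  by rewrite big_geq ?ltnS // divr_ge0 // mulr_ge0.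
have [dN|Nd] := leqP d N.*2; last first.
  rewrite big_nat big1 ?divr_ge0 ?mulr_ge0 // => n /andP[N0n nN].
  apply/eqP; rewrite eqb0 hits1; apply/negP => /dvdn_leq; lia.
have := @sum_periodic_dist R d (hits [fset h]%fset d) (nu [fset h]%fset d) N0.+1 (N - N0) d0.
rewrite addSn subnKC ?(ltnW N0N) // nu1 => /(_ _ _)/(le_trans (ler_norm _)) dist.
have {}dist : (\sum_(N0.+1 <= n < N.+1) hits [fset h]%fset d n)%:R <= 1 + (N - N0)%:R / d%:R :> R.
  rewrite -lerBlDr -[_ / _]mul1r mulrCA; apply: dist.
    by move=> n; rewrite -(hits_mod _ _ d (n + d)) // modnDr hits_mod.
  by rewrite sum_hits // nu1.
apply: (le_trans dist).
have -> : 3 * N%:R / d%:R = N.*2%:R / d%:R + N%:R / d%:R :> R.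
  by rewrite -mul2n natrM; field; rewrite gt_eqF.
apply: lerD; first by rewrite ler_pdivlMr // mul1r ler_nat.
by rewrite ler_pM2r ?invr_gt0 // ler_nat leq_subr.
Qed.

Lemma prod1D_sum_set (R : realType) (I : finType) (F : I -> R) :
  \prod_i (1 + F i) = \sum_(S : {set I}) \prod_(i in S) F i.
Proof.
under eq_bigr do rewrite addrC.
by rewrite bigA_distr; apply: eq_bigr => S _; rewrite -big_mkcond.
Qed.

Lemma natr_powR_prod (R : realType) (J : Type) (r : seq J) (P : pred J) (F : J -> nat) (s : R) :
  ((\prod_(i <- r | P i) F i)%N%:R : R) `^ s = \prod_(i <- r | P i) (F i)%:R `^ s.
Proof.
elim/big_rec2: _ => [|i y x _ <-]; first by rewrite powR1.
by rewrite natrM powRM.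
Qed.

Lemma ler_powR_npos (R : realType) (x y s : R) : 0 < x -> x <= y -> s <= 0 -> y `^ s <= x `^ s.
Proof.
move=> x0 xy s0; have y0 := lt_le_trans x0 xy.
rewrite -[s]opprK !(powRN _ (- s)) lef_pV2 ?posrE ?powR_gt0 //.
by apply: ge0_ler_powR; rewrite ?nnegrE ?oppr_ge0 // ltW.
Qed.

(** * The sieve by finitely many pairwise coprime moduli *)

Section FiniteSieve.
Variables (R : realType) (I : finType) (g : I -> nat) (H : {fset int}).
Hypothesis g_gt0 : forall i, (0 < g i)%N.
Hypothesis g_coprime : forall i j, i != j -> coprime (g i) (g j).

Let a (S : {set I}) : nat := (\prod_(i in S) g i)%N.
Let hitsS (S : {set I}) (n : nat) : nat := (\prod_(i in S) hits H (g i) n)%N.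
Let nuS (S : {set I}) : nat := (\prod_(i in S) nu H (g i))%N.

Let part (S : {set I}) (n : nat) (h : int) : {set I} :=
  [set i in S | hits [fset h]%fset (g i) n].

Let a_gt0 S : (0 < a S)%N. Proof. exact: prodn_gt0. Qed.

Let aR_gt0 S : 0 < (a S)%:R :> R. Proof. by rewrite ltr0n. Qed.

Lemma modulus_pairwise (S : {set I}) (P : pred I) :
  pairwise coprime [seq g i | i <- [seq i <- enum S | P i]].
Proof.
rewrite pairwise_map; have := filter_uniq P (enum_uniq (mem S)).
rewrite uniq_pairwise; apply: sub_pairwise => i j /=; exact: g_coprime.
Qed.

Lemma sum_hits_set_dist (S : {set I}) (m M : nat) :
  `|(\sum_(m <= n < m + M) hitsS S n)%:R - M%:R * ((nuS S)%:R / (a S)%:R)|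
    <= (nuS S)%:R :> R.
Proof.
apply: sum_periodic_dist; first exact: a_gt0.
  move=> n; apply: eq_bigr => i iS; congr nat_of_bool.
  have gaS : (g i %| a S)%N by rewrite /a (bigD1 i) //= dvdn_mulr.
  by rewrite -(hits_mod _ _ _ (n + a S) gaS) modnDr hits_mod.
have r0 : all (fun k => 0 < k)%N [seq g i | i <- enum S].
  by rewrite all_map; apply/allP => i _ /=.
have cr : pairwise coprime [seq g i | i <- enum S].
  by have := modulus_pairwise S predT; rewrite filter_predT.
have -> : nuS S = (\prod_(k <- [seq g i | i <- enum S]) nu H k)%N.
  by rewrite big_map big_enum.
rewrite -(sum_hits_prod H _ r0 cr) big_map big_enum.
by apply: eq_bigr => n _; rewrite big_map big_enum.
Qed.

(** Both terms expand into signed sums over [S]. Up to [Z] they are compared set by set through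
    [sum_hits_set_dist]; beyond [Z] the actual and expected counts are bounded separately. *)
Lemma sieve_dist (m M : nat) (Z : R) :
  `|(\sum_(m <= n < m + M) \prod_i ~~ hits H (g i) n)%:R
     - M%:R * \prod_i (1 - (nu H (g i))%:R / (g i)%:R)|
  <= \sum_(S : {set I} | (a S)%:R <= Z) (nuS S)%:R
     + M%:R * \sum_(S : {set I} | Z < (a S)%:R) (nuS S)%:R / (a S)%:R
     + \sum_(m <= n < m + M) \sum_(S : {set I} | Z < (a S)%:R) (hitsS S n)%:R :> R.
Proof.
pose X S : R := (\sum_(m <= n < m + M) hitsS S n)%:R.
pose Y S : R := M%:R * ((nuS S)%:R / (a S)%:R).
have XE : (\sum_(m <= n < m + M) \prod_i ~~ hits H (g i) n)%:R
    = \sum_(S : {set I}) (-1) ^+ #|S| * X S :> R.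
  rewrite natr_sum /X; under [RHS]eq_bigr do rewrite natr_sum mulr_sumr.
  rewrite exchange_big /=; apply: eq_bigr => n _.
  rewrite natr_prod (eq_bigr (fun i => 1 + - (hits H (g i) n)%:R)); last first.
    by move=> i _; case: hits; rewrite /= ?subrr ?subr0.
  rewrite prod1D_sum_set; apply: eq_bigr => S _.
  by rewrite prodrN /hitsS natr_prod.
have YE : M%:R * \prod_i (1 - (nu H (g i))%:R / (g i)%:R)
    = \sum_(S : {set I}) (-1) ^+ #|S| * Y S :> R.
  rewrite prod1D_sum_set mulr_sumr; apply: eq_bigr => S _.
  rewrite prodrN mulrCA /Y /nuS /a !natr_prod -prodfV -big_split /=.
  by rewrite mulrCA.
have Y_ge0 S : 0 <= Y S by rewrite !mulr_ge0 ?invr_ge0.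
have X_ge0 S : 0 <= X S by [].
rewrite XE YE -sumrB.
apply: (@le_trans _ _ (\sum_S `|X S - Y S|)).
  apply: (le_trans (ler_norm_sum _ _ _)); apply: ler_sum => S _.
  by rewrite -mulrBr normrM normrX normrN1 expr1n mul1r.
rewrite (bigID (fun S => (a S)%:R <= Z)) /= -addrA; apply: lerD.
  by apply: ler_sum => S _; exact: sum_hits_set_dist.
rewrite exchange_big mulr_sumr -big_split /=.
rewrite (eq_bigl (fun S => Z < (a S)%:R)) => [|S]; last by rewrite ltNge.
apply: ler_sum => S _; rewrite -natr_sum addrC.
apply: (le_trans (ler_normB _ _)); rewrite !ger0_norm //.
Qed.

Lemma dvd_modulus (S : {set I}) (d : nat) :
  (forall i, i \in S -> (g i %| d)%N) -> (a S %| d)%N.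
Proof.
move=> Sd; rewrite /a -big_enum.
apply/Gauss_dvd_prod; first exact: modulus_pairwise.
by move=> i; rewrite mem_enum => /Sd.
Qed.

(* [a S] divides the product over [h] of the moduli of the parts of [S] whose
   elements divide [n - h]; a modulus may occur in several parts. *)
Lemma modulus_le_exp (S : {set I}) (n : nat) (y : R) :
  (forall i, i \in S -> hits H (g i) n) ->
  (forall h, h \in H -> (a (part S n h))%:R <= y) ->
  (a S)%:R <= y ^+ #|` H|%fset.
Proof.
move=> hS ay.
pose factor (h : int) i := if hits [fset h]%fset (g i) n then g i else 1%N.
have -> : y ^+ #|` H|%fset = \prod_(h <- H) y.
  by rewrite big_const_seq count_predT -Monoid.iteropE /=.
apply: (@le_trans _ _ (\prod_(h <- H) a (part S n h))%N%:R).
  rewrite ler_nat.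
  rewrite (eq_bigr (fun h => \prod_(i in S) factor h i)%N); last first.
    move=> h _; rewrite /a /factor -big_mkcondr; by apply: eq_bigl => i; rewrite inE.
  rewrite exchange_big /=; apply: leq_prod => i iS.
  have /hitsP[h hH gh] := hS i iS; rewrite -hits1 in gh.
  rewrite (big_fsetD1 h) //= {1}/factor ifT //.
  by rewrite leq_pmulr // prodn_gt0 // => k; rewrite /factor; case: ifP.
rewrite natr_prod [leLHS]big_seq [leRHS]big_seq; apply: ler_prod => h hH.
by rewrite ler0n /= ay.
Qed.

Let u := #|` H|%fset.
(** Euler product of the sum of [u ^ #|S| * a S ^ (- s)] over all [S] (see [weight_sum]), where
    [u ^ #|S|] dominates [nuS S]. *)
Let W (s : R) : R := \prod_i (1 + u%:R * (g i)%:R `^ (- s)).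

Lemma weight_sum (s : R) : W s = \sum_(S : {set I}) u%:R ^+ #|S| * (a S)%:R `^ (- s).
Proof.
rewrite /W prod1D_sum_set; apply: eq_bigr => S _.
by rewrite big_split /= prodr_const natr_powR_prod.
Qed.

Let nuS_le S : (nuS S)%:R <= u%:R ^+ #|S| :> R.
Proof.
rewrite -natrX ler_nat -prod_nat_const; apply: leq_prod => i _; exact: nu_le.
Qed.

(* Rankin's trick: on the range of summation [(Z / a S) ^ s >= 1], and the sum
   over all [S] is then the product [W s]. *)
Lemma rankin_le (Z s : R) : 0 <= s ->
  \sum_(S : {set I} | (a S)%:R <= Z) (nuS S)%:R <= Z `^ s * W s.
Proof.
move=> s0; rewrite weight_sum mulr_sumr big_mkcond; apply: ler_sum => S _.
case: ifPn => [aZ|_]; last by rewrite !mulr_ge0 ?powR_ge0 ?exprn_ge0.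
rewrite mulrCA; apply: (le_trans (nuS_le S)); rewrite ler_peMr ?exprn_ge0 //.
rewrite powRN -ler_pdivrMr ?invr_gt0 ?powR_gt0 // mul1r invrK.
by apply: ge0_ler_powR; rewrite ?nnegrE // (le_trans _ aZ).
Qed.

(** Rankin's trick for the tail: as [s <= 1], the factor [a S ^ (s - 1)] is at most [Z ^ (s - 1)]
    there. A general [f] serves both [nuS] and the constant 1. *)
Lemma rankin_gt (f : {set I} -> R) (Z s : R) : 0 < Z -> s <= 1 ->
  (forall S, f S <= u%:R ^+ #|S|) ->
  \sum_(S : {set I} | Z < (a S)%:R) f S / (a S)%:R <= Z `^ (s - 1) * W s.
Proof.
move=> Z0 s1 fu; rewrite weight_sum mulr_sumr big_mkcond; apply: ler_sum => S _.
case: ifPn => [Za|_]; last by rewrite !mulr_ge0 ?powR_ge0 ?exprn_ge0.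
rewrite mulrCA; apply: (@le_trans _ _ (u%:R ^+ #|S| / (a S)%:R)).
  by rewrite ler_pM2r ?invr_gt0.
apply: ler_wpM2l; first exact: exprn_ge0.
have -> : (a S)%:R^-1 = (a S)%:R `^ (s - 1) * (a S)%:R `^ (- s) :> R.
  rewrite -powRD; last by rewrite (gt_eqF (aR_gt0 S)) implybT.
  by rewrite (_ : s - 1 + - s = -1) ?powR_inv1 //; ring.
rewrite ler_pM2r ?powR_gt0 //; apply: ler_powR_npos => //; first exact: ltW.
by rewrite subr_le0.
Qed.

(* If [S] is hit by [n] and [a S > z ^ u], splitting [S] according to the element
   of [H] responsible for each hit gives some [h] and a part [S'] of [S] with
   [a S' > z] and [a S'] dividing [n - h]; at most [2 ^ #|T|] sets [S] are hit
   by [n], where [T] is the set of all indices hit. *)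
Lemma sum_hits_gt_le (n : nat) (Y z e D : R) :
  0 <= e -> 0 <= D -> 0 <= Y ->
  (forall h, h \in H -> n%:Z != h /\ `|n%:Z - h|%N%:R <= Y) ->
  (forall T : {set I}, 2 ^+ #|T| <= D * (a T)%:R `^ e) ->
  \sum_(S : {set I} | z ^+ u < (a S)%:R) (hitsS S n)%:R
  <= D * (Y ^+ u) `^ e * \sum_(h <- H) \sum_(S : {set I} | z < (a S)%:R)
       (hits [fset h]%fset (a S) n)%:R.
Proof.
move=> e0 D0 Y0 HY Ddiv.
pose T : {set I} := [set i | hits H (g i) n]%SET.
have hitsE S : hitsS S n = (S \subset T).
  have [/fintype.subsetP ST|/fintype.subsetPn[i iS iT]] := boolP (S \subset T).
    by rewrite /hitsS big1 // => i /ST; rewrite inE => ->.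
  by rewrite /hitsS (bigD1 i) //=; move: iT; rewrite inE => /negbTE ->.
have hits_part S h : hits [fset h]%fset (a (part S n h)) n.
  rewrite hits1 dvdzE; apply: dvd_modulus => i; rewrite !inE => /andP[_].
  by rewrite hits1 dvdzE.
(* Apply [modulus_le_exp] to [T] with [y = Y]: the modulus of each part divides the nonzero
   [n - h]. *)
have aT_le : (a T)%:R <= Y ^+ u.
  apply: (@modulus_le_exp _ n) => [i|h hH]; first by rewrite inE.
  have [nh nhY] := HY h hH; apply: le_trans nhY; rewrite ler_nat.
  apply: dvdn_leq; first by rewrite absz_gt0 subr_eq0.
  by have := hits_part T h; rewrite hits1 dvdzE.
have [/existsP[S0 /andP[zS0 S0T]]|/existsPn noS] :=
  boolP [exists S : {set I}, (z ^+ u < (a S)%:R) && (S \subset T)]; last first.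
  rewrite [leLHS]big1 => [|S zS].
    by rewrite !mulr_ge0 ?powR_ge0 // sumr_ge0 // => h _; exact: sumr_ge0.
  by move: (noS S); rewrite zS /= hitsE => /negbTE ->.
(* Otherwise all parts of [S0] have modulus at most [z], forcing [a S0 <= z ^ u]. *)
have [h hH zh] : exists2 h, h \in H & z < (a (part S0 n h))%:R.
  apply/exists2P/not_existsP => noh.
  move: zS0; apply/negP; rewrite -leNgt; apply: (@modulus_le_exp _ n).
    by move=> i /(fintype.subsetP S0T); rewrite inE.
  by move=> h hH; rewrite leNgt; apply/negP => zh; apply: (noh h).
apply: (@le_trans _ _ (D * (Y ^+ u) `^ e)).
  apply: (@le_trans _ _ (2 ^+ #|T|)).
    rewrite -natrX -card_powerset -sum1_card natr_sum.
    rewrite big_mkcond [leRHS]big_mkcond; apply: ler_sum => S _.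
    by rewrite hitsE powersetE; case: ifP => _ //; case: ifP.
  apply: (le_trans (Ddiv T)); apply: ler_wpM2l => //.
  by apply: ge0_ler_powR; rewrite ?nnegrE ?exprn_ge0.
(* The double sum is at least 1, owing to the term of [h] and [part S0 n h]. *)
rewrite ler_peMr ?mulr_ge0 ?powR_ge0 // (big_fsetD1 h) //=.
rewrite (bigD1 (part S0 n h)) //= hits_part -addrA lerDl.
by rewrite addr_ge0 ?sumr_ge0 // => k _; rewrite ?sumr_ge0.
Qed.

(** Take [Z = z ^ u] in [sieve_dist]. The first two errors fall to [rankin_le] and [rankin_gt]; the
    third goes through [sum_hits_gt_le], then [count_hits1_le] for each modulus [a S > z], then
    [rankin_gt] again. *)
Lemma sieve_bound (N0 N : nat) (z s e D : R) :
  (0 < u)%N -> (N0 <= N)%N -> 1 <= z -> 0 <= s <= 1 -> 0 <= e -> 0 <= D ->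
  (forall h, h \in H -> (`|h| <= N0)%N) ->
  (forall T : {set I}, 2 ^+ #|T| <= D * (a T)%:R `^ e) ->
  `|(\sum_(N0.+1 <= n < N.+1) \prod_i ~~ hits H (g i) n)%:R
     - (N - N0)%:R * \prod_i (1 - (nu H (g i))%:R / (g i)%:R)|
  <= W s * ((z ^+ u) `^ s + N%:R * z `^ (s - 1)
            + 3 * u%:R * D * (N.*2%:R ^+ u) `^ e * N%:R * z `^ (s - 1)).
Proof.
move=> u0 N0N z1 /andP[s0 s1] e0 D0 HN0 Ddiv.
have z0 : 0 < z := lt_le_trans ltr01 z1.
have W0 : 0 <= W s.
  by apply: prodr_ge0 => i _; rewrite addr_ge0 ?mulr_ge0 ?powR_ge0.
have u1 (S : {set I}) : 1 <= u%:R ^+ #|S| :> R by rewrite exprn_ege1 ?ler1n.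
have -> : N.+1 = (N0.+1 + (N - N0))%N by rewrite addSn subnKC.
apply: (le_trans (sieve_dist _ _ (z ^+ u))).
rewrite [W s * _]mulrDr [W s * (_ + _)]mulrDr; apply: lerD; first apply: lerD.
- by rewrite mulrC; exact: rankin_le.
- rewrite mulrCA; apply: ler_pM => //; first by apply: sumr_ge0.
    by rewrite ler_nat leq_subr.
  rewrite mulrC; apply: (le_trans (@rankin_gt _ (z ^+ u) s _ s1 nuS_le)).
    exact: exprn_gt0.
  (* As [z <= z ^ u] and [s - 1 <= 0], the tail at [z ^ u] is weakened to the power of [z] that the
     third error also carries. *)
  apply: ler_wpM2r => //; apply: ler_powR_npos => //; last by rewrite subr_le0.
  exact: ler_eXnr.
pose B := D * (N.*2%:R ^+ u) `^ e.
have B0 : 0 <= B by rewrite mulr_ge0 ?powR_ge0.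
apply: (@le_trans _ _ (B * \sum_(h <- H)
   \sum_(S : {set I} | z < (a S)%:R) 3 * N%:R / (a S)%:R)).
  apply: (@le_trans _ _ (\sum_(N0.+1 <= n < N0.+1 + (N - N0)) B * \sum_(h <- H)
     \sum_(S : {set I} | z < (a S)%:R) (hits [fset h]%fset (a S) n)%:R)).
    rewrite big_nat [leRHS]big_nat; apply: ler_sum => n /andP[N0n nN].
    apply: sum_hits_gt_le => // h /HN0 hN0; rewrite ler_nat; split; last by lia.
    by apply/eqP; lia.
  rewrite -mulr_sumr; apply: ler_wpM2l => //.
  rewrite exchange_big [leLHS]big_seq [leRHS]big_seq; apply: ler_sum => h /HN0 hN0 /=.
  rewrite exchange_big; apply: ler_sum => S _ /=.
  by rewrite -natr_sum addSn subnKC //; exact: count_hits1_le.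
have -> : \sum_(h <- H) \sum_(S : {set I} | z < (a S)%:R) 3 * N%:R / (a S)%:R
    = u%:R * (3 * N%:R * \sum_(S : {set I} | z < (a S)%:R) 1 / (a S)%:R) :> R.
  rewrite big_const_seq count_predT iter_addr_0 -[LHS]mulr_natl; congr (_ * _).
  by rewrite mulr_sumr; apply: eq_bigr => S _; rewrite mul1r.
have := @rankin_gt (fun=> 1) z s z0 s1 u1; rewrite mulrC => sum_le.
have -> : W s * (3 * u%:R * D * (N.*2%:R ^+ u) `^ e * N%:R * z `^ (s - 1))
  = B * (u%:R * (3 * N%:R * (W s * z `^ (s - 1)))) by rewrite /B; ring.
by do 3![apply: ler_wpM2l; rewrite ?mulr_ge0 //].
Qed.

End FiniteSieve.

(** * Convergence of the sum of [g ^ (- s)] over [G], from condition A *)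

(** Comparison with the integral of [t ^ (- p)]: the sharper bound [1 + (1 - n ^ (- q)) / q], with
    [q = p - 1], goes through by induction. *)
Lemma pseries_bounded (R : realType) (p : R) : 1 < p ->
  exists K : R, forall n, \sum_(1 <= k < n.+1) (k%:R : R) `^ (- p) <= K.
Proof.
move=> p1; pose q := p - 1; have q0 : 0 < q by rewrite subr_gt0.
exists (1 + q^-1).
suff H n : \sum_(1 <= k < n.+2) (k%:R : R) `^ (- p) <= 1 + q^-1 - q^-1 * n.+1%:R `^ (- q).
  case=> [|n]; first by rewrite big_geq // addr_ge0 // invr_ge0 ltW.
  by apply: (le_trans (H n)); rewrite gerDl oppr_le0 mulr_ge0 ?powR_ge0 // invr_ge0 ltW.
elim: n => [|n IH]; first by rewrite big_nat1 !powR1 mulr1 addrK.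
rewrite big_nat_recr //=; apply: (le_trans (lerD IH (lexx _))).
set x : R := n.+1%:R; set y : R := n.+2%:R.
have x0 : 0 < x by rewrite ltr0n.
have y0 : 0 < y by rewrite ltr0n.
have yx : x = y * (1 - y^-1).
  by rewrite mulrBr mulr1 divff ?gt_eqF // /y -[n.+2]addn1 natrD addrK.
have t0 : 0 < 1 - y^-1 by rewrite -(pmulr_rgt0 _ y0) -yx.
have -> : y `^ (- p) = y^-1 * y `^ (- q).
  have -> : - p = -1 + - q by rewrite /q; ring.
  by rewrite powRD ?(gt_eqF y0) ?implybT // powR_inv1 // ltW.
(* Write the power as [expR (- q * ln (1 - y^-1))] and use [expR t >= 1 + t] and
   [ln (1 + t) <= t]. *)
have ge1 : 1 + q * y^-1 <= (1 - y^-1) `^ (- q).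
  rewrite /powR gt_eqF //; apply: le_trans (expR_ge1Dx _); rewrite lerD2l.
  rewrite mulNr -mulrN ler_pM2l // lerNr; apply: le_ln1Dx.
  by rewrite ltrNl opprK -subr_gt0.
have : (1 + q * y^-1) * y `^ (- q) <= x `^ (- q).
  rewrite yx powRM ?(ltW t0) ?(ltW y0) // [leLHS]mulrC; apply: ler_wpM2l => //; exact: powR_ge0.
set Y := y `^ (- q); set X := x `^ (- q) => le_X.
suff : y^-1 * Y <= q^-1 * (X - Y).
  by rewrite mulrBr; move: (q^-1 * X) (q^-1 * Y) (y^-1 * Y) q^-1 => b c d e; lra.
rewrite ler_pdivlMl // lerBrDr.
by have -> : q * (y^-1 * Y) + Y = (1 + q / y) * Y by ring.
Qed.

(** The inner sum is the rank of [g] in [G], and ranks of successive elements run through 1, 2, 3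
    and so on without gaps. *)
Lemma sum_rank (R : realType) (G : set nat) (F : nat -> R) (L : nat) :
  \sum_(0 <= g < L | g \in G) F (\sum_(0 <= k < g.+1 | k \in G) 1)%N
  = \sum_(1 <= k < (\sum_(0 <= k < L | k \in G) 1).+1) F k.
Proof.
elim: L => [|L IH]; first by rewrite !big_geq.
rewrite big_mkcond big_nat_recr //= -big_mkcond IH /=.
have cntS : (\sum_(0 <= k < L.+1 | k \in G) 1 =
   (\sum_(0 <= k < L | k \in G) 1) + (L \in G))%N.
  rewrite big_mkcond big_nat_recr //= -big_mkcond /=.
  by case: (L \in G).
rewrite cntS; case: (L \in G); last by rewrite addr0 addn0.
by rewrite addn1 [RHS]big_nat_recr.
Qed.

(* With exponent [A0], the truncation at [x ^ A0] is void for [y = x ^ A0], so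
   condition A bounds the products, hence the elements of [G], up to any [y]. *)
Lemma count_le_powR (R : realType) (G : set nat) (theta A0 : R) :
  (forall g, G g -> (0 < g)%N) -> 0 < A0 -> 0 < theta ->
  condition_A theta (products_le G A0) ->
  exists2 C : R, 0 < C & forall m : nat, (0 < m)%N ->
    (\sum_(0 <= g < m.+1 | g \in G) 1)%N%:R <= C * m%:R `^ theta.
Proof.
move=> G0 A0_gt0 theta0 [_ /(_ A0 1 1 A0_gt0 ltr01 ltr01)[C1 [M [_ HM]]]].
pose M1 := Num.max M 1.
(* For [m > m0] the point [x = m ^ (1 / A0)] exceeds the threshold [M], and [ln m >= 1]; the term
   [m0.+1] of the constant absorbs the smaller [m]. *)
pose m0 := Num.bound (Num.max (M1 `^ A0) (expR 1)).
exists (`|C1| + m0.+1%:R) => [|m m_gt0]; first by rewrite ltr_wpDl.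
have m1 : 1 <= m%:R :> R by rewrite ler1n.
have mt1 : 1 <= m%:R `^ theta :> R by have := ler_powR m1 (ltW theta0); rewrite powRr0.
have [m_le|m_gt] := leqP m m0.
  apply: (@le_trans _ _ (m0.+1%:R)).
    rewrite ler_nat; apply: (@leq_trans (\sum_(0 <= g < m.+1) 1)).
      by rewrite big_mkcond leq_sum // => i _; case: ifP.
    by rewrite sum_nat_const_nat muln1 subn0 ltnS.
  apply: (@le_trans _ _ (`|C1| + m0.+1%:R)); first by rewrite lerDr.
  by rewrite ler_peMr // addr_ge0.
have m_big : Num.max (M1 `^ A0) (expR 1) < m%:R.
  apply: (lt_trans (archi_boundP _)); first by rewrite le_max expR_ge0 orbT.
  by rewrite ltr_nat.
move: m_big; rewrite gt_max => /andP[mM me].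
pose x := m%:R `^ A0^-1 : R.
have xE : x `^ A0 = m%:R by rewrite /x -powRrM mulVf ?gt_eqF // powRr1.
have Mx : M < x.
  have M1_ge0 : 0 <= M1 by rewrite le_max ler01 orbT.
  apply: (@le_lt_trans _ _ M1); first by rewrite le_max lexx.
  rewrite ltNge; apply/negP => xM; move: mM; apply/negP; rewrite -leNgt -xE.
  by apply: ge0_ler_powR; rewrite ?nnegrE ?powR_ge0 // ltW.
have := HM x Mx m%:R; rewrite mul1r xE => /(_ (lexx _)) cnt_le.
apply: (@le_trans _ _ (count_upto (products_le G A0 x) (m%:R : R))%:R).
  rewrite ler_nat sum1_count -size_filter; apply: uniq_leq_size.
    by rewrite filter_uniq // iota_uniq.
  move=> g; rewrite mem_filter mem_index_iota ltnS => /andP[/set_mem Gg /andP[_ gm]].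
  rewrite in_fset_set; last exact: finite_upto.
  apply/mem_set; split; last by split; [exact: G0|rewrite ler_nat].
  split; last by rewrite xE ler_nat.
  (* Each element of [G] is the product over its own singleton, so condition A counts it. *)
  exists [fset g]%fset; last by rewrite big_seq_fset1.
  by move=> k /= /fset1P ->.
apply: (le_trans cnt_le).
have ln1 : 1 <= ln (m%:R : R).
  by rewrite -[leLHS]expRK ler_ln ?posrE ?expR_gt0 ?ltr0n // ltW.
have ln_le1 : ln (m%:R : R) `^ (- 1) <= 1.
  by rewrite powR_inv1 ?(le_trans ler01) // invf_le1 // (lt_le_trans ltr01).
apply: (@le_trans _ _ (`|C1| * m%:R `^ theta)); last first.
  by rewrite ler_wpM2r ?powR_ge0 // lerDl.
apply: (le_trans (ler_wpM2r _ (ler_norm C1))); first by rewrite mulr_ge0 ?powR_ge0.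
by apply: ler_wpM2l => //; rewrite ler_piMr ?powR_ge0.
Qed.

(* The rank [c] of [g] in [G] is at most [C g ^ theta], so [g ^ - s] is bounded by
   a multiple of [c ^ (- s / theta)]. *)
Lemma sum_powR_bounded (R : realType) (G : set nat) (theta A0 s : R) :
  (forall g, G g -> (0 < g)%N) -> 0 < A0 -> 0 < theta -> theta < s ->
  condition_A theta (products_le G A0) ->
  exists K : R, forall L, \sum_(0 <= g < L | g \in G) (g%:R : R) `^ (- s) <= K.
Proof.
move=> G0 A0_gt0 theta0 theta_s condA.
have [C C0 HC] := count_le_powR _ _ _ _ G0 A0_gt0 theta0 condA.
pose p := s / theta; have p1 : 1 < p by rewrite ltr_pdivlMr // mul1r.
have [K HK] := pseries_bounded _ _ p1.
exists (C `^ p * K) => L.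
apply: (@le_trans _ _ (C `^ p * \sum_(0 <= g < L | g \in G)
    (\sum_(0 <= k < g.+1 | k \in G) 1)%N%:R `^ (- p))); last first.
  by rewrite (sum_rank _ _ (fun k => k%:R `^ (- p))) ler_wpM2l ?powR_ge0.
rewrite mulr_sumr; apply: ler_sum => g /[dup] gG /set_mem Gg.
have g0 := G0 g Gg; have gR : 0 < g%:R :> R by rewrite ltr0n.
set c := (\sum_(0 <= k < g.+1 | k \in G) 1)%N.
have c0 : 0 < c%:R :> R.
  by rewrite ltr0n /c big_mkcond big_nat_recr //= gG addn1.
have cg : c%:R / C <= g%:R `^ theta by rewrite ler_pdivrMr // mulrC HC.
have -> : C `^ p * c%:R `^ (- p) = (c%:R / C) `^ (- p).
  by rewrite powRM ?invr_ge0 ?(ltW C0) // -powR_inv1 ?(ltW C0) // -powRrM mulrNN mul1r mulrC.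
have -> : - s = theta * - p by rewrite /p mulrN mulrCA mulfV ?mulr1 ?gt_eqF.
rewrite powRrM; apply: ler_powR_npos => //; first by rewrite divr_gt0.
by rewrite oppr_le0 ltW // (lt_trans ltr01).
Qed.

(** * The divisor bound, and the sieve uniform in the truncation of [G] *)

(** Every [g i >= m], where [m] exceeds [2 ^ (1 / e)], pays for its own factor 2 with [g i ^ e]. By
    injectivity at most [m] indices have [g i < m], so [D = 2 ^ m] depends on [e] alone. *)
Lemma exp2_card_le (R : realType) (e : R) : 0 < e ->
  exists2 D : R, 0 <= D & forall (I : finType) (g : I -> nat),
    injective g -> (forall i, (0 < g i)%N) ->
    forall T : {set I}, 2 ^+ #|T| <= D * (\prod_(i in T) g i)%N%:R `^ e.
Proof.
move=> e0; pose m := Num.bound ((2 : R) `^ e^-1); exists (2 ^+ m) => // I g g_inj g0 T.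
have small k : (m <= k)%N -> 2 <= (k%:R : R) `^ e.
  move=> mk; have le2 : (2 : R) `^ e^-1 <= k%:R.
    by apply: (le_trans (ltW (archi_boundP (powR_ge0 _ _)))); rewrite ler_nat.
  have -> : 2 = ((2 : R) `^ e^-1) `^ e by rewrite -powRrM mulVf ?gt_eqF // powRr1.
  by apply: ge0_ler_powR; rewrite ?nnegrE ?powR_ge0 // ltW.
have ge1 i : 1 <= ((g i)%:R : R) `^ e.
  have := @ler_powR R (g i)%:R _ 0 e (ltW e0); rewrite powRr0; apply.
  by rewrite ler1n.
apply: (@le_trans _ _ (\prod_(i in T) ((if (g i < m)%N then 2 else 1) * (g i)%:R `^ e))).
  rewrite -prodr_const; apply: ler_prod => i _; rewrite ler0n /=.
  by case: ltnP => [_|/small]; rewrite ?mul1r // ler_peMr.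
rewrite big_split /= natr_powR_prod; apply: ler_wpM2r; first exact: prodr_ge0.
rewrite -big_mkcondr prodr_const; apply: ler_weXn2l; first by rewrite ler1n.
have [m_0|m_gt0] := posnP m.
  by rewrite eq_card0 // => i; rewrite unfold_in /= m_0 ltn0 andbF.
(* The default value of [insubd] is never reached on the indices counted, which satisfy
   [g i < m]. *)
pose f (i : I) : 'I_m := insubd (Ordinal m_gt0) (g i).
rewrite -[leqRHS]card_ord; apply: (leq_card_in f) => i j; rewrite !unfold_in /= => /andP[_ im] /andP[_ jm].
move=> /(congr1 (@nat_of_ord _)); rewrite /f !val_insubd im jm; exact: g_inj.
Qed.

(* The bound does not depend on [L], so that the truncated density can later be
   replaced by its limit. *)
Lemma sieve_uniform (R : realType) (G : set nat) (H : {fset int}) (theta A0 s e : R) :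
  (forall g, G g -> (0 < g)%N) -> pairwise_coprime G ->
  0 < A0 -> 0 < theta -> theta < s <= 1 -> 0 < e ->
  condition_A theta (products_le G A0) ->
  exists2 K : R, 0 <= K & forall (L N0 N : nat) (z : R),
    (0 < #|` H|%fset)%N -> (N0 <= N)%N -> 1 <= z ->
    (forall h, h \in H -> (`|h| <= N0)%N) ->
    `|(\sum_(N0.+1 <= n < N.+1) \prod_(0 <= g < L | g \in G) ~~ hits H g n)%N%:R
       - (N - N0)%:R * density_partial R G H L|
    <= K * ((z ^+ #|` H|%fset) `^ s + N%:R * z `^ (s - 1)
            + (N.*2%:R ^+ #|` H|%fset) `^ e * N%:R * z `^ (s - 1)).
Proof.
move=> G0 coG A0_gt0 theta0 /andP[theta_s s1] e0 condA.
set u := #|` H|%fset.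
have [K HK] := sum_powR_bounded R G theta A0 s G0 A0_gt0 theta0 theta_s condA.
have [D D0 HD] := exp2_card_le R e e0.
have c1 : 1 <= 1 + 3 * u%:R * D by rewrite lerDl !mulr_ge0.
(* The exponential bounds the Euler product through [1 + t <= expR t]; the second factor absorbs the
   coefficient of the third error. *)
exists (expR (u%:R * K) * (1 + 3 * u%:R * D)) => [|L N0 N z u0 N0N z1 HN0].
  by rewrite mulr_ge0 ?expR_ge0 // (le_trans ler01).
(* The elements of [G] below [L], indexed by position, form the finite family given to
   [sieve_bound]. *)
set r := [seq g <- index_iota 0 L | g \in G].
pose g (i : 'I_(size r)) := tnth (in_tuple r) i.
have gG i : G (g i).
  have := mem_tnth i (in_tuple r); rewrite mem_filter => /andP[/set_mem + _].
  by [].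
have g_gt0 i : (0 < g i)%N by exact: G0.
have g_inj : injective g.
  by apply/tuple_uniqP; rewrite filter_uniq // iota_uniq.
have g_coprime i j : i != j -> coprime (g i) (g j).
  by move=> ij; apply: coG => // /g_inj; exact/eqP.
have s01 : 0 <= s <= 1 by rewrite s1 ltW // (lt_trans theta0).
have := @sieve_bound R _ g H g_gt0 g_coprime N0 N z s e D u0 N0N z1 s01 (ltW e0) D0 HN0 (HD _ g g_inj g_gt0).
rewrite /density_partial -[in X in _ -> X](@big_filter _ _ _ _ _ (fun g => g \in G)) -/r (big_tnth _ _ r).
have -> : (\sum_(N0.+1 <= n < N.+1) \prod_(0 <= g < L | g \in G) ~~ hits H g n
    = \sum_(N0.+1 <= n < N.+1) \prod_i ~~ hits H (g i) n)%N.
  by apply: eq_bigr => n _; rewrite -big_filter -/r big_tnth.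
move/le_trans; apply.
set W := \prod_i _; have W_le : W <= expR (u%:R * K).
  apply: (@le_trans _ _ (expR (u%:R * \sum_i (g i)%:R `^ (- s)))).
    rewrite mulr_sumr expR_sum; apply: ler_prod => i _.
    by rewrite expR_ge1Dx addr_ge0 ?mulr_ge0 ?powR_ge0.
  rewrite ler_expR; apply: ler_wpM2l => //.
  by have := HK L; rewrite -big_filter -/r big_tnth.
have W0 : 0 <= W by apply: prodr_ge0 => i _; rewrite addr_ge0 ?mulr_ge0 ?powR_ge0.
rewrite -[leRHS]mulrA; apply: ler_pM => //.
  by rewrite !addr_ge0 ?mulr_ge0 ?powR_ge0.
rewrite -/u; set p := _ + N%:R * _; set t := (N.*2%:R ^+ u) `^ e * N%:R * z `^ (s - 1).
have p0 : 0 <= p by rewrite addr_ge0 ?mulr_ge0 ?powR_ge0.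
have t0 : 0 <= t by rewrite !mulr_ge0 ?powR_ge0.
have -> : 3 * u%:R * D * (N.*2%:R ^+ u) `^ e * N%:R * z `^ (s - 1) = 3 * u%:R * D * t.
  by rewrite /t; ring.
rewrite -subr_ge0.
have -> : (1 + 3 * u%:R * D) * (p + t) - (p + 3 * u%:R * D * t) = t + 3 * u%:R * D * p.
  by ring.
by rewrite addr_ge0 // !mulr_ge0.
Qed.

(** * The sifted count, the choice of exponents and the limit density *)

Lemma count_uptoE (R : realType) (A : set nat) (x : R) : 0 <= x ->
  count_upto A x = (\sum_(1 <= n < (Num.truncn x).+1) (n \in A))%N.
Proof.
move=> x0; rewrite (eq_bigr (fun n => if n \in A then 1 else 0)%N); last first.
  by move=> n _; case: (n \in A).
rewrite -big_mkcond sum1_count -size_filter.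
apply/perm_size/uniq_perm; rewrite ?fset_uniq ?filter_uniq ?iota_uniq // => n.
rewrite in_fset_set; last exact: finite_upto.
rewrite mem_filter mem_index_iota ltnS truncn_ge_nat //.
apply/idP/and3P => [/set_mem [An [n0 nx]]|[/set_mem An n0 nx]].
  by split => //; exact/mem_set.
by apply/mem_set; split.
Qed.

(** As [0 < |n - h| <= n + N0 < 2 n < L], no modulus [g >= L] divides [n - h], so the moduli below
    [L] already decide membership. *)
Lemma mem_sifted (G : set nat) (H : {fset int}) (L N0 n : nat) :
  (forall h, h \in H -> (`|h| <= N0)%N) -> (N0 < n)%N -> (n.*2 < L)%N ->
  (n \in sifted G H) = (\prod_(0 <= g < L | g \in G) ~~ hits H g n)%N :> nat.
Proof.
move=> HN0 N0n nL.
have [/set_mem[n0 nH]|nS] := boolP (n \in sifted G H).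
  rewrite big1 // => g /set_mem Gg; apply/eqP; rewrite eqb1.
  apply/hitsP => -[h hH gh]; move: (nH h g hH Gg).
  by rewrite eqz_mod_dvd gh.
apply/esym/eqP; rewrite -leqn0 leqNgt; apply/negP => prod_gt0.
move: nS; rewrite notin_setE; apply; split => [|h g hH Gg].
  exact: leq_ltn_trans N0n.
rewrite eqz_mod_dvd; apply/negP => gh.
have gL : (g < L)%N.
  have := HN0 h hH; move: gh; rewrite dvdzE => /dvdn_leq; lia.
have hit : hits H g n by apply/hitsP; exists h.
move: prod_gt0; rewrite big_mkord (bigD1 (Ordinal gL)) /= ?hit //.
exact/mem_set.
Qed.

(* With [w = 1 / (u theta - theta + 1)] the two main terms balance:
   [1 + w (theta - 1) = w u theta]. *)
Lemma sieve_error_le (R : realType) (u N : nat) (theta eps d e x : R) :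
  (0 < u)%N -> 0 < theta -> 0 < d -> 0 < e ->
  u%:R * d <= eps / 2 -> u%:R * e <= eps / 2 -> 1 <= x -> N%:R <= x ->
  forall z, z = x `^ (u%:R * theta - theta + 1)^-1 ->
  (z ^+ u) `^ (theta + d) + N%:R * z `^ (theta + d - 1)
    + (N.*2%:R ^+ u) `^ e * N%:R * z `^ (theta + d - 1)
  <= (2 + 2 `^ (u%:R * e)) * x `^ (u%:R * theta / (u%:R * theta - theta + 1) + eps).
Proof.
move=> u0 theta0 d0 e0 ud ue x1 Nx.
have u1 : 1 <= u%:R :> R by rewrite ler1n.
have ut : theta <= u%:R * theta by rewrite ler_peMl // ltW.
set v := u%:R * theta - theta + 1; have v1 : 1 <= v by rewrite /v; lra.
have v0 : 0 < v := lt_le_trans ltr01 v1.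
set w := v^-1; have w0 : 0 < w by rewrite invr_gt0.
have w1 : w <= 1 by rewrite invf_le1.
have vw : w * v = 1 by rewrite mulVf ?gt_eqF.
move=> z zE; set E := _ + eps.
have x0 : 0 <= x := le_trans ler01 x1.
have xn0 : x != 0 by rewrite gt_eqF // (lt_le_trans ltr01).
have wd : w * d <= d by rewrite ler_piMl // ltW.
have dud : d <= u%:R * d by rewrite ler_peMl // ltW.
have ud0 : 0 <= u%:R * d by rewrite mulr_ge0 // ltW.
have ue0 : 0 <= u%:R * e by rewrite mulr_ge0 // ltW.
have wud : w * (u%:R * d) <= u%:R * d by rewrite ler_piMl.
have t1 : (z ^+ u) `^ (theta + d) <= x `^ E.
  rewrite zE -powR_mulrn; last exact: powR_ge0.
  rewrite -!powRrM; apply: ler_powR => //.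
  have -> : w * (u%:R * (theta + d)) = u%:R * theta * w + w * (u%:R * d) by ring.
  by rewrite /E lerD2l; lra.
have wE : 1 + w * (theta + d - 1) = u%:R * theta * w + w * d.
  by rewrite -{1}vw /v; ring.
have Nz : N%:R * z `^ (theta + d - 1) <= x `^ (u%:R * theta * w + w * d).
  rewrite -wE [leRHS]powRD ?xn0 ?implybT // powRr1 // zE -powRrM.
  by apply: ler_wpM2r => //; exact: powR_ge0.
have t2 : N%:R * z `^ (theta + d - 1) <= x `^ E.
  by apply: (le_trans Nz); apply: ler_powR => //; rewrite /E; lra.
(* The constant [2 ^ (u * e)] comes from [N.*2 <= 2 * x]; the exponent losses [w * d] and [u * e]
   together stay within [eps]. *)
have t3 : (N.*2%:R ^+ u) `^ e * N%:R * z `^ (theta + d - 1)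
    <= 2 `^ (u%:R * e) * x `^ E.
  rewrite -mulrA; apply: (@le_trans _ _ ((2 `^ (u%:R * e) * x `^ (u%:R * e))
      * x `^ (u%:R * theta * w + w * d))).
    apply: ler_pM => //; rewrite ?mulr_ge0 ?powR_ge0 //.
    rewrite -powR_mulrn // -powRrM -powRM //; apply: ge0_ler_powR; rewrite ?nnegrE //.
      exact: mulr_ge0.
    by rewrite -mul2n natrM ler_wpM2l.
  rewrite -mulrA; apply: ler_wpM2l; first exact: powR_ge0.
  by rewrite -powRD ?xn0 ?implybT //; apply: ler_powR => //; rewrite /E; lra.
by rewrite mulrDl mulr2n mulrDl mul1r; apply: lerD => //; exact: lerD.
Qed.

Lemma density_partial_itv (R : realType) (G : set nat) (H : {fset int}) (N : nat) :
  admissible G H -> 0 <= density_partial R G H N <= 1.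
Proof.
move=> adm.
have fac g : g \in G -> 0 <= (1 - (nu H g)%:R / g%:R : R) <= 1.
  move=> /set_mem /adm lt_nu; have g0 : 0 < g%:R :> R.
    by rewrite ltr0n (leq_ltn_trans _ lt_nu).
  by rewrite subr_ge0 ler_pdivrMr // mul1r ler_nat ltnW //= gerBl divr_ge0.
rewrite /density_partial prodr_ge0 => [|g /fac/andP[]//]; exact: Num.Theory.prodr_ile1.
Qed.

Theorem theorem1p4 (R : realType) (G : set nat) (u : nat) (H : {fset int})
    (theta A0 : R)
    (G_pos : forall g, G g -> (0 < g)%N)
    (G_coprime : pairwise_coprime G)
    (H_card : #|` H|%fset = u)
    (H_adm : admissible G H)
    (A0_gt0 : 0 < A0)
    (theta_gt0 : 0 < theta) (theta_lt1 : theta < 1)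
    (G_condA : condition_A theta (products_le G A0)) :
  forall eps : R, 0 < eps ->
    exists C : R, \forall x \near +oo,
      `|(count_upto (sifted G H) x)%:R - density R G H * x|
        <= C * x `^ (u%:R * theta / (u%:R * theta - theta + 1) + eps).
Proof.
move=> eps eps0; set E := _ + eps.
have E0 : 0 <= E.
  rewrite addr_ge0 ?(ltW eps0) // divr_ge0 ?mulr_ge0 ?(ltW theta_gt0) //.
  by rewrite -addrA addr_ge0 ?mulr_ge0 ?(ltW theta_gt0) // addrC subr_ge0 ltW.
(* A common bound for all [|h|]; the sieve runs over [n > N0] only. *)
pose N0 := (\sum_(h <- H) `|h|)%N.
have HN0 h : h \in H -> (`|h| <= N0)%N.
  by move=> hH; rewrite /N0 (big_fsetD1 h) //= leq_addr.
have [K K0 HK] : exists2 K : R, 0 <= K & forall (L N : nat) (x : R),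
    (N0 <= N)%N -> 1 <= x -> N%:R <= x ->
    `|(\sum_(N0.+1 <= n < N.+1) \prod_(0 <= g < L | g \in G) ~~ hits H g n)%N%:R
       - (N - N0)%:R * density_partial R G H L| <= K * x `^ E.
  (* With [H] empty nothing is sifted out and the error is 0; [sieve_uniform] handles nonempty
     [H]. *)
  have [u_0|u_gt0] := posnP u.
    have H0 : H = fset0 by apply/eqP; rewrite -cardfs_eq0 H_card u_0.
    exists 0 => // L N x N0N _ _.
    have -> : density_partial R G H L = 1.
      rewrite /density_partial big1 // => g _.
      have : (nu H g <= 0)%N by rewrite -u_0 -H_card nu_le.
      by rewrite leqn0 => /eqP ->; rewrite mul0r subr0.
    rewrite (eq_bigr (fun=> 1%N)) => [|n _].
      by rewrite sum_nat_const_nat muln1 subSS mulr1 subrr normr0 mul0r.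
    rewrite big1 // => g _; apply/eqP; rewrite eqb1.
    by apply/hitsP => -[h]; rewrite H0 in_fset0.
  have u0R : 0 < u%:R :> R by rewrite ltr0n.
  (* The minimum keeps the exponent [s = theta + d] at most 1; [d] and [e] each cost at most
     [eps / 2] after multiplication by [u]. *)
  pose d := Num.min (eps / (2 * u%:R)) (1 - theta).
  pose e := eps / (2 * u%:R).
  have e0 : 0 < e by rewrite divr_gt0 // mulr_gt0.
  have ue : u%:R * e <= eps / 2 by rewrite /e le_eqVlt; apply/orP; left; apply/eqP; field; rewrite gt_eqF.
  have d0 : 0 < d by rewrite lt_min e0 subr_gt0.
  have ud : u%:R * d <= eps / 2.
    by apply: le_trans ue; rewrite ler_pM2l // ge_min lexx.
  have s_itv : theta < theta + d <= 1.
    by rewrite ltrDl d0 -lerBrDl ge_min lexx orbT.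
  have [K K0 HK] := sieve_uniform R G H theta A0 (theta + d) e G_pos
    G_coprime A0_gt0 theta_gt0 s_itv e0 G_condA.
  exists (K * (2 + 2 `^ (u%:R * e))) => [|L N x N0N x1 Nx].
    by rewrite mulr_ge0 // addr_ge0 ?powR_ge0.
  rewrite H_card in HK.
  have x0 : 0 <= x := le_trans ler01 x1.
  have ut : theta <= u%:R * theta by rewrite ler_peMl ?ler1n // ltW.
  have z1 : 1 <= x `^ (u%:R * theta - theta + 1)^-1.
    have le0w : 0 <= (u%:R * theta - theta + 1)^-1.
      by rewrite invr_ge0 addr_ge0 // subr_ge0.
    by have := ler_powR x1 le0w; rewrite powRr0.
  apply: (le_trans (HK L N0 N _ u_gt0 N0N z1 HN0)).
  by rewrite -[leRHS]mulrA; apply: ler_wpM2l => //; exact: (sieve_error_le _ _ _ _ eps).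
(* [K] covers the sieve; [N0.*2.+1] covers the at most [N0] sifted integers up to [N0] and the gap
   [x - (N - N0) <= N0 + 1]. *)
exists (K + N0.*2.+1%:R); exists N0.+1%:R; split=> // x N0x.
have x1 : 1 <= x by apply: le_trans (ltW N0x); rewrite ler1n.
have x0 : 0 <= x := le_trans ler01 x1.
have /andP[Nx xN] := truncn_itv x0.
set N := Num.truncn x in Nx xN.
have N0N : (N0 <= N)%N by rewrite ltnW // truncn_gt_nat ltW.
(* For every [L > 2 N] the moduli below [L] give the exact count beyond [N0], so the inequality
   holds with the truncated density and passes to the limit in [L]. *)
apply: (@cvgr_to_le _ \oo _ _ (fun L => `|(count_upto (sifted G H) x)%:R
    - density_partial R G H L * x|)).
  apply: cvg_norm; apply: cvgB; first exact: cvg_cst.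
  by apply: cvgMr_tmp; exact: cvg_density.
exists N.*2.+1 => // L /= NL.
have /andP[dp0 dp1] := density_partial_itv R G H L H_adm.
set dp := density_partial R G H L in dp0 dp1 *.
have := HK L N x N0N x1 Nx; rewrite -/dp.
set S := (\sum_(N0.+1 <= n < N.+1) _)%N => HS.
have cntE : count_upto (sifted G H) x
    = (\sum_(1 <= n < N0.+1) (n \in sifted G H) + S)%N.
  rewrite count_uptoE // -/N (@big_cat_nat _ _ _ N0.+1) //=; congr (_ + _)%N.
  rewrite big_nat [RHS]big_nat; apply: eq_bigr => n /andP[N0n nN].
  by apply: (mem_sifted _ _ _ N0) => //; lia.
set r := (\sum_(1 <= n < N0.+1) _)%N in cntE.
have rN0 : (r <= N0)%N.
  apply: (@leq_trans (\sum_(1 <= n < N0.+1) 1)).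
    by apply: leq_sum => n _; exact: leq_b1.
  by rewrite sum_nat_const_nat muln1 subSS subn0.
have xE1 : 1 <= x `^ E by have := ler_powR x1 E0; rewrite powRr0.
rewrite cntE natrD mulrDl.
have -> : r%:R + S%:R - dp * x
    = S%:R - (N - N0)%:R * dp + (r%:R - dp * (x - (N - N0)%:R)) by ring.
apply: (le_trans (ler_normD _ _)); apply: lerD => //.
apply: (@le_trans _ _ N0.*2.+1%:R); last by rewrite ler_peMr.
apply: (le_trans (ler_normB _ _)).
have -> : N0.*2.+1%:R = N0%:R + N0.+1%:R :> R by rewrite -natrD addnS addnn.
rewrite normr_nat; apply: lerD; first by rewrite ler_nat.
have lo : 0 <= x - (N - N0)%:R by rewrite natrB //; have := ler0n R N0; lra.
rewrite ger0_norm ?mulr_ge0 //; apply: (le_trans (ler_piMl lo dp1)).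
by rewrite natrB // -[N0.+1]addn1 natrD; move: xN; rewrite -[N.+1]addn1 natrD; lra.
Qed.
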